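(* Let $N,n,m$ be integers with $-1\le n<N-3$, $m\ge 1$ and $n+m\le N-2$, and let $c\in(0,1)$. Then no rule that computes $\mathbb{P}(n+2)$ from the iterations up to index $n+m$ is always optimal. Precisely: there exist positive numbers $a_0,\dots,a_{n+m}$, satisfying in the case $n\ge 0$ also $a_n>a_{n+1}$ and $c<\dfrac{a_n-a_{n+1}}{a_n}$, such that for every real $p\ge 0$ there exist positive numbers $a_{n+m+1},\dots,a_{N-1}$ for which the following holds: no probability distribution $\mathbb{P}$ on $\{0,\dots,N\}$ with $\mathbb{P}(j)=0$ for $0\le j\le n$, $\mathbb{P}(n+1)=c$ and $\mathbb{P}(n+2)=p$ is an optimal truncation distribution for $a_0,\dots,a_{N-1}$.
   Context: A Krylov method (conjugate gradient or conjugate residual) with $N$ iterations numbered $0,\dots,N-1$ enters only through the positive numbers $a_j=\alpha_j\|q_j\|$, where $\alpha_j$ is the step size and $\|q_j\|$ is the norm of the search direction $p_j$ ($\|p_j\|_A$ for conjugate gradient, $\|Ap_j\|_2$ for conjugate residual); $a_j$ becomes known when iteration $j$ is performed. Here these ''iteration components'' are treated as arbitrary positive numbers; in particular no monotonicity of $(a_j)$ is assumed in general. $\mathbb{P}(j)$ is the probability of truncating before iteration $j$ ($\mathbb{P}(N)$: performing all iterations). For a probability distribution $\mathbb{P}$ on $\{0,\dots,N\}$ define $$\|v_j\|^2=\sum_{k=0}^{j-1}\left(1-\frac{1}{1-\sum_{i=0}^k\mathbb{P}(i)}\right)^2a_k^2+\sum_{k=j}^{N-1}a_k^2,\qquad 0\le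 j\le N,$$ (empty sums are $0$) and the objective $F(\mathbb{P})=\sum_{j=0}^N\mathbb{P}(j)\|v_j\|^2$, with $F(\mathbb{P})=+\infty$ if $\mathbb{P}(N)=0$. A distribution $\mathbb{P}$ is an optimal truncation distribution for $a_0,\dots,a_{N-1}$ if it minimizes $F$ among all probability distributions $\mathbb{P}'$ on $\{0,\dots,N\}$ with the same average number of iterations, $\sum_j j\,\mathbb{P}'(j)=\sum_j j\,\mathbb{P}(j)$. *)

(* Defs.v *)
From mathcomp Require Import all_boot all_order all_algebra.
From mathcomp Require Import reals constructive_ereal.

Set Implicit Arguments.
Unset Strict Implicit.
Unset Printing Implicit Defensive.

Import Order.TTheory GRing.Theory Num.Theory.
Local Open Scope ring_scope.

Definition is_distribution (R : realType) (N : nat) (P : 'I_N.+1 -> R) : Prop :=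
  (forall j, 0 <= P j) /\ \sum_(j < N.+1) P j = 1.

Definition mean_iterations (R : realType) (N : nat) (P : 'I_N.+1 -> R) : R :=
  \sum_(j < N.+1) j%:R * P j.

(* Only a 0, ..., a N.-1 are used. *)
Definition sqnorm_v (R : realType) (N : nat) (a : nat -> R)
    (P : 'I_N.+1 -> R) (j : 'I_N.+1) : R :=
  \sum_(k < N | (k < j)%N)
     (1 - 1 / (1 - \sum_(i < N.+1 | (i <= k)%N) P i)) ^+ 2 * a k ^+ 2
  + \sum_(k < N | (j <= k)%N) a k ^+ 2.

(* For a distribution with P N != 0, every denominator in sqnorm_v is nonzero,
   so the convention 1 / 0 = 0 never affects the finite branch. *)
Definition objective (R : realType) (N : nat) (a : nat -> R)
    (P : 'I_N.+1 -> R) : \bar R :=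
  if P ord_max == 0 then +oo%E
  else (\sum_(j < N.+1) P j * sqnorm_v a P j)%:E.

Definition optimal_truncation (R : realType) (N : nat) (a : nat -> R)
    (P : 'I_N.+1 -> R) : Prop :=
  is_distribution P /\
  forall P' : 'I_N.+1 -> R,
    is_distribution P' -> mean_iterations P' = mean_iterations P ->
    (objective a P <= objective a P')%E.

(* Main.v *)
Require Import Defs.
From mathcomp Require Import all_boot all_order all_algebra.
From mathcomp Require Import reals constructive_ereal.
From mathcomp Require Import ring lra zify.

Set Implicit Arguments.
Unset Strict Implicit.
Unset Printing Implicit Defensive.

Import Order.TTheory GRing.Theory Num.Theory.
Local Open Scope ring_scope.

(** Write U j for the probability of not truncating before iteration j.  Both
    the mean and the objective are simple in these coordinates: the mean is
    the sum of the U k.+1 for k < N, and the objective is the sum of the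
    a k ^+ 2 * (1 / U k.+1 - 1).  Optimal truncation is therefore the convex
    problem of minimizing the sum of the a k ^+ 2 / U k.+1 among nonincreasing
    sequences with U 0 = 1 and a prescribed sum ([optimal_survivalP]).

    Put t = n + 1.  The distributions in question have U t = 1,
    U t.+1 = 1 - c and U t.+2 = 1 - c - p.  Apart from the monotonicity
    constraint, the minimizer is proportional to a, so past t it follows a as
    long as a is nonincreasing there, but it must be flattened when a
    increases later.  Hence the value of U t.+2 depends on iterations that
    come arbitrarily late.

    Take a t = 1 and a k = 1/2 for the other known indices k > t; before t,
    take a so large that the condition on c holds.  If all later components
    are also 1/2, proportionality forces U t.+2 = (1 - c) / 2, that is
    p = (1 - c) / 2 ([optimal_survival_proportional]).  This refutes every
    other value of p.  For p = (1 - c) / 2 itself, take all later components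
    equal to N: then the drop from U t.+1 to U t.+2 = U t.+1 / 2 is too large,
    since raising the end of the sequence would gain more than lowering
    U t.+1 costs ([optimal_survival_lt_double]). *)

(** * Survival probabilities *)

Definition survival (R : realType) (N : nat) (P : 'I_N.+1 -> R) (j : nat) : R :=
  \sum_(i < N.+1 | (j <= i)%N) P i.

(** The sequence is prolonged by U N.+1 = 0 so that the distribution is
    recovered from it, including its last entry, as the differences
    U j - U j.+1.  The condition 0 < U N is finiteness of the objective. *)
Definition is_survival (R : realType) (N : nat) (U : nat -> R) : Prop :=
  [/\ U 0%N = 1, U N.+1 = 0, 0 < U N &
      forall j, (j <= N)%N -> U j.+1 <= U j].

(** This differs from the objective by the sum of the a k ^+ 2, which does not
    depend on the distribution. *)
Definition survival_cost (R : realType) (N : nat) (a U : nat -> R) : R :=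
  \sum_(k < N) a k ^+ 2 / U k.+1.

Definition optimal_survival (R : realType) (N : nat) (a U : nat -> R) : Prop :=
  is_survival N U /\
  forall V, is_survival N V ->
    \sum_(k < N) V k.+1 = \sum_(k < N) U k.+1 ->
    survival_cost N a U <= survival_cost N a V.

Section Survival.
Variables (R : realType) (N : nat).
Implicit Types (P : 'I_N.+1 -> R) (a U V : nat -> R).

Lemma survival_pred P (i : 'I_N.+1) :
  survival P i = P i + survival P i.+1.
Proof.
rewrite /survival (bigD1 i) //=; congr (_ + _).
by apply: eq_bigl => j; rewrite ltn_neqAle andbC eq_sym.
Qed.

Lemma survival_last P : survival P N.+1 = 0.
Proof. by rewrite /survival big1 // => i; rewrite leqNgt ltn_ord. Qed.

Lemma survival0 P : is_distribution P -> survival P 0 = 1.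
Proof. by case. Qed.

Lemma survival_compl P (k : nat) : is_distribution P ->
  1 - \sum_(i < N.+1 | (i <= k)%N) P i = survival P k.+1.
Proof.
case=> _ <-; rewrite (bigID (fun i : 'I_N.+1 => (i <= k)%N)) /=.
rewrite addrAC subrr add0r.
by apply: eq_bigl => i; rewrite -ltnNge.
Qed.

(** The expectation of a nonnegative integer is the sum of its tail
    probabilities. *)
Lemma mean_survival P : mean_iterations P = \sum_(k < N) survival P k.+1.
Proof.
rewrite /survival /mean_iterations (exchange_big_dep xpredT) //=.
apply: eq_bigr => j _.
rewrite -(big_ord_widen N (fun=> P j)) ?sumr_const ?card_ord ?mulr_natl //.
by rewrite -ltnS.
Qed.

Lemma le_is_survival U (i j : nat) : is_survival N U ->
  (i <= j)%N -> (j <= N.+1)%N -> U j <= U i.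
Proof.
case=> _ _ _ mono leij; rewrite -(subnKC leij).
elim: (j - i)%N => [|d IHd]; first by rewrite addn0.
rewrite addnS => lt_dN; apply: le_trans (IHd _); first exact: mono.
exact: ltnW.
Qed.

Lemma is_survival_gt0 U (j : nat) : is_survival N U -> (j <= N)%N -> 0 < U j.
Proof.
move=> sU lejN; have [_ _ UN _] := sU.
exact: lt_le_trans UN (le_is_survival sU lejN _).
Qed.

Lemma survivalP P : is_distribution P -> P ord_max != 0 ->
  is_survival N (survival P).
Proof.
move=> dP PN; split; rewrite ?survival_last ?survival0 //.
  have := survival_pred P ord_max; rewrite survival_last addr0 => ->.
  by rewrite lt_def PN dP.1.
move=> j lejN; have := survival_pred P (Ordinal (lejN : (j < N.+1)%N)) => /= ->.
by rewrite lerDr dP.1.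
Qed.

(** Exchanging the sums over j and k, component k contributes
    (1 - 1 / u) ^+ 2 with probability u = U k.+1, and 1 with probability
    1 - u; these add up to 1 / u - 1. *)
Lemma objective_survival a P : is_distribution P -> P ord_max != 0 ->
  objective a P =
  (survival_cost N a (survival P) - \sum_(k < N) a k ^+ 2)%:E.
Proof.
move=> dP PN; rewrite /objective (negbTE PN); congr (_%:E).
have sP := survivalP dP PN.
pose X k := (1 - 1 / survival P k.+1) ^+ 2 * a k ^+ 2.
transitivity (\sum_(k < N) (survival P k.+1 * X k
                            + (1 - survival P k.+1) * a k ^+ 2)).
  transitivity (\sum_(j < N.+1) (\sum_(k < N | (k < j)%N) P j * X k +
                  \sum_(k < N | (j <= k)%N) P j * a k ^+ 2)).
    apply: eq_bigr => j _; rewrite /sqnorm_v mulrDr !mulr_sumr; congr (_ + _).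
    by apply: eq_bigr => k _; rewrite survival_compl.
  rewrite !big_split /=; congr (_ + _); rewrite (exchange_big_dep xpredT) //=;
    apply: eq_bigr => k _; rewrite -mulr_suml //.
  by rewrite -survival_compl // subKr.
rewrite /survival_cost -sumrB; apply: eq_bigr => k _; rewrite /X.
by field; rewrite gt_eqF // is_survival_gt0.
Qed.

Lemma survival_diff U (j : nat) : is_survival N U -> (j <= N.+1)%N ->
  survival (fun i : 'I_N.+1 => U i - U i.+1) j = U j.
Proof.
move=> [_ UN _ _] lejN; rewrite /survival.
rewrite -(big_geq_mkord j N.+1 xpredT (fun i => U i - U i.+1)).
under eq_bigr do rewrite -opprB.
by rewrite sumrN telescope_sumr // UN sub0r opprK.
Qed.

Lemma diff_distribution U : is_survival N U ->
  is_distribution (fun i : 'I_N.+1 => U i - U i.+1).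
Proof.
move=> sU; have [U0 _ _ mono] := sU; split=> [j|].
  by rewrite subr_ge0 mono // -ltnS.
by rewrite -[RHS]U0 -(survival_diff sU).
Qed.

(** Optimality passes to survival sequences because each of them comes from a
    distribution.  An optimal distribution has P N != 0 because some
    distribution with the same mean has a finite objective; for this the mean
    must be positive. *)
Lemma optimal_survivalP a P : optimal_truncation a P ->
  0 < mean_iterations P -> optimal_survival N a (survival P).
Proof.
move=> [dP optP] mean_gt0.
have optV V : is_survival N V ->
    \sum_(k < N) V k.+1 = \sum_(k < N) survival P k.+1 ->
    (objective a P <= (survival_cost N a V - \sum_(k < N) a k ^+ 2)%:E)%E.
  move=> sV sumV; have [_ VN1 VN _] := sV.
  pose Q := fun i : 'I_N.+1 => V i - V i.+1.
  have QN : Q ord_max != 0 by rewrite /Q /= VN1 subr0 gt_eqF.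
  have sQ (k : 'I_N) : survival Q k.+1 = V k.+1.
    by apply: survival_diff => //; rewrite ltnS ltnW.
  have := optP Q (diff_distribution sV).
  rewrite !mean_survival -sumV (eq_bigr _ (fun k _ => sQ k)) => /(_ erefl).
  rewrite [objective _ Q]objective_survival //; last exact: diff_distribution.
  rewrite /survival_cost (eq_bigr (fun k : 'I_N => a k ^+ 2 / V k.+1)) //.
  by move=> k _; rewrite sQ.
have PN : P ord_max != 0.
  apply/negP => PN.
  have N_gt0 : 0 < N%:R :> R.
    rewrite ltr0n lt0n; apply: contraTneq mean_gt0 => N0.
    rewrite mean_survival big1 ?ltxx // => k _.
    by have := ltn_ord k; rewrite [X in (_ < X)%N]N0.
  have mean_leN : mean_iterations P <= N%:R.
    rewrite -[leRHS]mulr1 -[X in _ <= _ * X]dP.2 mulr_sumr.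
    apply: ler_sum => j _; by apply: ler_wpM2r; rewrite ?dP.1 // ler_nat -ltnS.
  (* The competitor truncates either at once or never. *)
  pose V j : R := if j == 0%N then 1 else
    if (j <= N)%N then mean_iterations P / N%:R else 0.
  have mN : 0 < mean_iterations P / N%:R <= 1.
    by rewrite divr_gt0 //= ler_pdivrMr // mul1r.
  have sV : is_survival N V.
    split; rewrite /V //= ?ltnn ?leqnn //.
      by case: eqP; lra.
    move=> j lejN; rewrite lejN; case: eqP => _; case: ifP => _; lra.
  suff sumV : \sum_(k < N) V k.+1 = \sum_(k < N) survival P k.+1.
    by have := optV V sV sumV; rewrite /objective PN leNgt ltry.
  rewrite -mean_survival /V; under eq_bigr => k _ do rewrite /= ltn_ord.
  by rewrite sumr_const card_ord -[LHS]mulr_natr divfK // gt_eqF.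
split=> [|V sV sumV]; first exact: survivalP.
by have := optV V sV sumV; rewrite objective_survival // lee_fin lerD2r.
Qed.
End Survival.

(** * Minimizers of the survival cost *)

Section Minimizers.
Variables (R : realType) (N : nat).
Implicit Types (a U V : nat -> R).

(** Past a strict drop at t, the constraint U t.+1 <= U t is inactive, so it
    does not prevent a small move towards the sequence W that agrees with U up
    to t and continues proportionally to a with the same sum.  As the cost is
    convex, U cannot cost more than W.  By the equality case of the
    Cauchy-Schwarz inequality for the a k / sqrt (U k.+1) and the
    sqrt (U k.+1), it then coincides with W. *)
Lemma optimal_survival_proportional a U (t : nat) : optimal_survival N a U ->
  (t < N)%N -> U t.+1 < U t ->
  (forall k, (t <= k < N)%N -> 0 < a k) ->
  (forall k, (t <= k)%N -> (k.+1 < N)%N -> a k.+1 <= a k) ->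
  exists sigma, forall k, (t <= k < N)%N -> U k.+1 = sigma * a k.
Proof.
move=> [sU optU] lt_tN dropU a_gt0 a_mono.
have [U0 UN1 UN monoU] := sU.
pose T := \sum_(k < N | (t <= k)%N) U k.+1.
pose A := \sum_(k < N | (t <= k)%N) a k.
have sum_gt0 (f : nat -> R) : (forall k, (t <= k < N)%N -> 0 < f k) ->
    0 < \sum_(k < N | (t <= k)%N) f k.
  move=> f_gt0; rewrite (bigD1 (Ordinal lt_tN)) //=.
  rewrite ltr_pwDl ?f_gt0 ?leqnn // sumr_ge0 // => k /andP[le_tk _].
  by rewrite ltW // f_gt0 // le_tk ltn_ord.
have U_gt0 k : (k < N)%N -> 0 < U k.+1 by exact: is_survival_gt0.
have A_gt0 : 0 < A by apply: sum_gt0.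
have T_gt0 : 0 < T by apply: (sum_gt0 (fun k => U k.+1)) => k /andP[_ /U_gt0].
pose sigma := T / A.
have sigma_gt0 : 0 < sigma by exact: divr_gt0.
exists sigma.
pose W k := if (k < t)%N then U k.+1 else sigma * a k.
have W_gt0 k : (k < N)%N -> 0 < W k.
  move=> lt_kN; rewrite /W; case: ltnP => [_|le_tk]; first exact: U_gt0.
  by rewrite mulr_gt0 // a_gt0 // le_tk.
have sumW : \sum_(k < N) W k = \sum_(k < N) U k.+1.
  rewrite (bigID (fun k : 'I_N => (t <= k)%N)).
  rewrite [RHS](bigID (fun k : 'I_N => (t <= k)%N)) /=.
  congr (_ + _); last by apply: eq_bigr => k; rewrite -ltnNge /W => ->.
  under eq_bigr => k le_tk do rewrite /W ltnNge le_tk /=.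
  by rewrite -mulr_sumr divfK // gt_eqF.
(* The step is small enough for the increase eps * W t to fit in the drop at
   t; only this bound links the moved part to the unchanged one. *)
pose eps := (U t - U t.+1) / ((U t - U t.+1) + sigma * a t).
have at_gt0 : 0 < sigma * a t by rewrite mulr_gt0 // a_gt0 // leqnn.
have eps01 : 0 < eps < 1.
  by rewrite divr_gt0 ?ltr_pdivrMr /=; lra.
have epsW : eps * W t <= U t - U t.+1.
  rewrite /W ltnn /eps mulrAC ler_pdivrMr; last lra.
  rewrite ler_wpM2l; lra.
pose V j := if j is k.+1 then
  if (k < N)%N then (1 - eps) * U k.+1 + eps * W k else 0 else 1.
have VE k : (k < N)%N -> V k.+1 = (1 - eps) * U k.+1 + eps * W k.
  by move=> lt_kN; rewrite /V lt_kN.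
have Vlow j : (j <= t)%N -> V j = U j.
  case: j => [|k] lt_kt //; rewrite VE ?(ltn_trans lt_kt) // /W lt_kt; ring.
have V_gt0 k : (k < N)%N -> 0 < V k.+1.
  move=> lt_kN; rewrite VE //; have := U_gt0 _ lt_kN; have := W_gt0 _ lt_kN.
  by nra.
have sV : is_survival N V.
  split; rewrite ?[V N.+1]/V ?ltnn //.
    by have := V_gt0 N.-1; rewrite prednK ?(leq_ltn_trans _ lt_tN) //; apply; lia.
  move=> j; rewrite leq_eqVlt => /predU1P[->|lt_jN].
    rewrite {1}/V ltnn; case: (N) lt_tN V_gt0 => // N' _ /(_ N').
    by move=> /(_ (leqnn _))/ltW.
  have [lt_jt|le_tj] := ltnP j t; first by rewrite !Vlow ?monoU // ltnW.
  have := monoU j (ltnW lt_jN); rewrite VE //.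
  move: le_tj; rewrite leq_eqVlt => /predU1P[<-|lt_tj].
    rewrite Vlow // => ?; have := U_gt0 _ lt_tN; by nra.
  case: j lt_tj lt_jN => [//|k] le_tk lt_kN.
  rewrite VE ?(ltnW lt_kN) // /W !ltnNge (ltnW le_tk) (le_tk : (t <= k)%N) /= => ?.
  have := a_mono k le_tk lt_kN; move=> ?; apply: lerD; first by nra.
  by rewrite ler_wpM2l ?ler_wpM2l //; lra.
have sumV : \sum_(k < N) V k.+1 = \sum_(k < N) U k.+1.
  under eq_bigr => k _ do rewrite VE //.
  by rewrite big_split /= -!mulr_sumr sumW; ring.
have leUV := optU V sV sumV.
have leUW : \sum_(k < N) (a k ^+ 2 / U k.+1 - a k ^+ 2 / W k) <= 0.
  rewrite sumrB.
  have convex : survival_cost N a V <=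
      (1 - eps) * survival_cost N a U + eps * \sum_(k < N) a k ^+ 2 / W k.
    rewrite /survival_cost !mulr_sumr -big_split; apply: ler_sum => k _.
    rewrite VE //=; have u := U_gt0 _ (ltn_ord k); have w := W_gt0 _ (ltn_ord k).
    have := V_gt0 _ (ltn_ord k); rewrite VE // => v.
    have -> : (1 - eps) * (a k ^+ 2 / U k.+1) + eps * (a k ^+ 2 / W k) =
        a k ^+ 2 * ((1 - eps) * W k + eps * U k.+1) / (U k.+1 * W k).
      by field; rewrite !gt_eqF.
    rewrite ler_pdivrMr // mulrAC ler_pdivlMr ?mulr_gt0 //.
    rewrite -[leRHS]mulrA; apply: ler_wpM2l; first exact: sqr_ge0.
    rewrite -subr_ge0 [X in 0 <= X](_ : _ = eps * (1 - eps) * (U k.+1 - W k) ^+ 2).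
      by rewrite mulr_ge0 ?sqr_ge0 // mulr_ge0; lra.
    by ring.
  have : eps * (survival_cost N a U - \sum_(k < N) a k ^+ 2 / W k) <= 0 by lra.
  by rewrite pmulr_rle0 //; case/andP: eps01.
(* The terms that are linear in U and W cancel in the sum, and complete the
   square in each summand. *)
pose g k := (a k ^+ 2 / U k.+1 - a k ^+ 2 / W k) + (U k.+1 - W k) / sigma ^+ 2.
have gE k : (t <= k < N)%N -> g k = (a k - U k.+1 / sigma) ^+ 2 / U k.+1.
  move=> /andP[le_tk lt_kN]; rewrite /g /W ltnNge le_tk /=.
  field; rewrite !gt_eqF ?U_gt0 ?a_gt0 ?le_tk //.
have g_ge0 (k : 'I_N) : xpredT k -> 0 <= g k.
  move=> _; have [lt_kt|le_tk] := ltnP k t.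
    by rewrite /g /W lt_kt !subrr mul0r addr0.
  by rewrite gE ?le_tk ?ltn_ord // divr_ge0 ?sqr_ge0 // ltW // U_gt0.
have sumg : \sum_(k < N) g k = 0.
  apply/eqP; rewrite eq_le sumr_ge0 // andbT big_split /=.
  rewrite -mulr_suml [X in X / _]sumrB.
  by rewrite sumW subrr mul0r addr0.
move=> k /andP[le_tk lt_kN].
have /eqP : g k = 0 by exact: (psumr_eq0P g_ge0 sumg (i := Ordinal lt_kN)).
rewrite gE ?le_tk // mulf_eq0 invr_eq0 (gt_eqF (U_gt0 _ lt_kN)) orbF.
by rewrite sqrf_eq0 subr_eq0 => /eqP ->; rewrite mulrC divfK // gt_eqF.
Qed.

(** A large last component keeps the earlier survival probabilities from
    dropping fast.  If U t.+1 were at least twice U t.+2, then multiplying all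
    U j with j > t.+1 by 1 + 1/N, at the expense of U t.+1, would keep the
    sequence nonincreasing.  It would leave at least U t.+1 / 2 at t.+1, hence
    add at most 1 / U t.+1 to the cost, while the last component alone would
    save at least N ^+ 2 / (N + 1) times 1 / U N >= 2 / U t.+1. *)
Lemma optimal_survival_lt_double a U (t : nat) : optimal_survival N a U ->
  (t.+1 < N)%N -> a t = 1 -> N%:R <= a N.-1 -> U t.+1 < 2%:R * U t.+2.
Proof.
move=> [sU optU] lt_tN at1 aN; rewrite ltNge; apply/negP => half.
have [U0 UN1 UN monoU] := sU.
have U_gt0 k : (k < N)%N -> 0 < U k.+1 by exact: is_survival_gt0.
have lt_tN' := ltnW lt_tN.
set s := U t.+1 in half *.
have s_gt0 : 0 < s by apply: U_gt0; apply: ltnW.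
have N2 : 2%:R <= N%:R :> R by rewrite ler_nat; apply: leq_trans lt_tN.
pose T := \sum_(k < N | (t < k)%N) U k.+1.
have tail_le k : (t < k < N)%N -> U k.+1 <= s / 2%:R.
  move=> /andP[lt_tk lt_kN].
  by have := le_is_survival sU (lt_tk : (t.+2 <= k.+1)%N) (leqW lt_kN); lra.
have T_le : T <= (N%:R - 1) * (s / 2%:R).
  have -> : (N%:R - 1) * (s / 2%:R) =
            \sum_(k < N | k != Ordinal lt_tN') (s / 2%:R).
    apply/esym/(@addrI _ (s / 2%:R)).
    rewrite -(bigD1 (Ordinal lt_tN') (P := xpredT)) //=.
    by rewrite sumr_const card_ord -[LHS]mulr_natr; ring.
  rewrite /T big_mkcond [leRHS]big_mkcond; apply: ler_sum => k _.
  have [lt_tk|le_kt] := ltnP t k; last by case: ifP => // _; lra.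
  by rewrite -val_eqE /= gtn_eqF // tail_le // lt_tk ltn_ord.
have T_ge0 : 0 <= T.
  by apply: sumr_ge0 => k _; rewrite ltW // U_gt0.
pose eta : R := N%:R^-1.
have eta_gt0 : 0 < eta by rewrite invr_gt0; lra.
have etaT : eta * T <= s / 2%:R - eta * (s / 2%:R).
  have -> : s / 2%:R - eta * (s / 2%:R) = eta * ((N%:R - 1) * (s / 2%:R)).
    by rewrite /eta; field; lra.
  by rewrite ler_wpM2l // ltW.
pose V j := if (j <= t)%N then U j else
  if j == t.+1 then s - eta * T else (1 + eta) * U j.
have Vt : V t.+1 = s - eta * T by rewrite /V ltnn eqxx.
have Vtail j : (t.+1 < j)%N -> V j = (1 + eta) * U j.
  by move=> lt_tj; rewrite /V leqNgt (ltnW lt_tj) /= gtn_eqF.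
have sV : is_survival N V.
  split.
  - by rewrite /V leq0n.
  - by rewrite Vtail ?UN1 ?mulr0 // ltnW.
  - by rewrite Vtail // mulr_gt0 //; lra.
  - move=> j le_jN; have := monoU j le_jN.
    have [lt_jt|] := ltnP j t; first by rewrite /V (ltnW lt_jt) lt_jt.
    rewrite leq_eqVlt => /predU1P[<-|].
      by rewrite Vt /V leqnn -/s; have := mulr_ge0 (ltW eta_gt0) T_ge0; lra.
    rewrite leq_eqVlt => /predU1P[<- _|lt_tj].
      rewrite Vt Vtail //.
      by have := tail_le t.+1; rewrite ltnSn lt_tN => /(_ isT); nra.
    rewrite !Vtail ?ltnS ?(ltnW lt_tj) // => ?.
    by rewrite ler_wpM2l //; lra.
have sumV : \sum_(k < N) V k.+1 = \sum_(k < N) U k.+1.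
  transitivity (\sum_(k < N) (U k.+1 - (if k == Ordinal lt_tN' then eta * T else 0)
                               + eta * (if (t < k)%N then U k.+1 else 0))).
    apply: eq_bigr => k _; rewrite -val_eqE /=.
    have [lt_kt|lt_tk|eq_kt] := ltngtP (k : nat) t.
    - by rewrite /V lt_kt; ring.
    - by rewrite Vtail //; ring.
    - by rewrite eq_kt Vt /s; ring.
  rewrite big_split sumrB -mulr_sumr -!big_mkcond big_pred1_eq /=.
  by rewrite -/T subrK.
have := optU V sV sumV; apply/negP; rewrite -ltNge -subr_gt0.
rewrite /survival_cost -sumrB.
have last_lt : (N.-1 < N)%N by lia.
rewrite (bigD1 (Ordinal lt_tN')) //= (bigD1 (Ordinal last_lt)) /=; last first.
  by rewrite -val_eqE /=; lia.
have first_term : - s^-1 <= a t ^+ 2 / s - a t ^+ 2 / V t.+1.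
  rewrite at1 expr1n !mul1r Vt.
  have : (s - eta * T)^-1 <= (s / 2%:R)^-1.
    have : 0 <= eta * (s / 2%:R) by apply: mulr_ge0; lra.
    by move=> ?; rewrite lef_pV2 ?posrE; lra.
  have -> : (s / 2%:R)^-1 = s^-1 + s^-1 by field; rewrite gt_eqF.
  lra.
have last_term : 2%:R / s <= a N.-1 ^+ 2 / U N.-1.+1 - a N.-1 ^+ 2 / V N.-1.+1.
  have N1E : N.-1.+1 = N by lia.
  have Uw := tail_le N.-1; rewrite N1E in Uw *.
  have {Uw} Uw : U N <= s / 2%:R by apply: Uw; lia.
  rewrite (Vtail N) //.
  have -> : a N.-1 ^+ 2 / U N - a N.-1 ^+ 2 / ((1 + eta) * U N) =
            (a N.-1 ^+ 2 / (N%:R + 1)) / U N.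
    by rewrite /eta; field; rewrite !gt_eqF //=; lra.
  have leUs : 2%:R / s <= (U N)^-1.
    by rewrite -[2%:R / s]invf_div lef_pV2 ?posrE //; lra.
  apply: le_trans leUs _; apply: ler_peMl; first by rewrite invr_ge0 ltW.
  by rewrite ler_pdivlMr; nra.
have rest : 0 <= \sum_(k < N | (k != Ordinal lt_tN') && (k != Ordinal last_lt))
    (a k ^+ 2 / U k.+1 - a k ^+ 2 / V k.+1).
  apply: sumr_ge0 => k /andP[neq_kt _]; rewrite subr_ge0.
  apply: ler_wpM2l; first exact: sqr_ge0.
  have Uk := U_gt0 _ (ltn_ord k).
  have leUV : U k.+1 <= V k.+1.
    have [lt_kt|lt_tk|eq_kt] := ltngtP k t.
    - by rewrite /V lt_kt.
    - by rewrite Vtail //; nra.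
    - by move: neq_kt; rewrite -val_eqE /= eq_kt eqxx.
  by rewrite lef_pV2 // posrE; apply: lt_le_trans leUV.
have s1_gt0 : 0 < s^-1 by rewrite invr_gt0.
by rewrite /= -/s; lra.
Qed.
End Minimizers.

(** * Truncation probabilities depend on late iterations *)

Theorem theorem2p4 (R : realType) (N m : nat) (n : int) (c : R)
    (hn : -1 <= n) (hnN : n < N%:Z - 3) (hm : (1 <= m)%N)
    (hnm : n + m%:Z <= N%:Z - 2) (hc : 0 < c < 1) :
  exists a : nat -> R,
    (forall j : nat, j%:Z <= n + m%:Z -> 0 < a j) /\
    (forall k : nat, n = k%:Z ->
       a k > a k.+1 /\ c < (a k - a k.+1) / a k) /\
    forall p : R, 0 <= p ->
      exists b : nat -> R,
        (forall j : nat, j%:Z <= n + m%:Z -> b j = a j) /\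
        (forall j : nat, n + m%:Z < j%:Z -> (j < N)%N -> 0 < b j) /\
        ~ exists P : 'I_N.+1 -> R,
            is_distribution P /\
            (forall j : 'I_N.+1, (j : nat)%:Z <= n -> P j = 0) /\
            (forall j : 'I_N.+1, (j : nat)%:Z = n + 1 -> P j = c) /\
            (forall j : 'I_N.+1, (j : nat)%:Z = n + 2 -> P j = p) /\
            optimal_truncation b P.
Proof.
have [t tE] : exists t : nat, t%:Z = n + 1 by exists (absz (n + 1)); lia.
have c2_gt0 : 0 < 1 - c by lra.
pose a j : R := if (j < t)%N then 2%:R / (1 - c)
                else if j == t then 1 else 2%:R^-1.
have a_gt0 j : 0 < a j.
  rewrite /a; case: ifP => _; first by rewrite divr_gt0.
  by case: ifP => _; rewrite ?invr_gt0.
exists a; split=> [j _|]; first exact: a_gt0.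
split=> [k nk|p p_ge0].
  have -> : a k = 2%:R / (1 - c) by rewrite /a ifT //; lia.
  have -> : a k.+1 = 1 by rewrite /a ifF ?ifT //; lia.
  have -> : (2%:R / (1 - c) - 1) / (2%:R / (1 - c)) = 1 - (1 - c) / 2%:R.
    by field; rewrite gt_eqF.
  by rewrite ltr_pdivlMr //; lra.
pose b := if p == (1 - c) / 2%:R then
            fun j => if (j < t + m)%N then a j else N%:R else a.
exists b; split=> [j le_j|].
  by rewrite /b; case: ifP => // _; rewrite ifT //; lia.
split=> [j _ lt_jN|].
  rewrite /b; case: ifP => // _; case: ifP => // _.
  by rewrite ltr0n; lia.
case=> P [dP [P0 [Pc [Pp optP]]]].
have Ut j : (j <= t)%N -> survival P j = 1.
  elim: j => [|j IHj] lt_jt; first exact: survival0.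
  have lt_jN : (j < N.+1)%N by lia.
  have := survival_pred P (Ordinal lt_jN); rewrite P0 /=; last lia.
  by rewrite add0r => <-; apply: IHj; apply: ltnW.
have lt_tN : (t < N.+1)%N by lia.
have lt_t1N : (t.+1 < N.+1)%N by lia.
have Ut1 : survival P t.+1 = 1 - c.
  have := survival_pred P (Ordinal lt_tN); rewrite Pc /=; last lia.
  by rewrite Ut //; lra.
have Ut2 : survival P t.+2 = 1 - c - p.
  have := survival_pred P (Ordinal lt_t1N); rewrite Pp /=; last lia.
  by rewrite Ut1; lra.
have mean_gt0 : 0 < mean_iterations P.
  rewrite mean_survival (bigD1 (Ordinal (lt_t1N : (t < N)%N))) //= Ut1.
  rewrite ltr_pwDl // sumr_ge0 // => k _.
  by apply: sumr_ge0 => i _; apply: dP.1.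
have := optimal_survivalP optP mean_gt0; rewrite /b.
case: eqP => [pE|/eqP pE] optU.
  have := optimal_survival_lt_double optU (t := t); rewrite Ut1 Ut2 pE.
  have -> : (t.+1 < N)%N by lia.
  have -> : (t < t + m)%N by lia.
  have -> : (N.-1 < t + m)%N = false by lia.
  by rewrite /a ltnn eqxx lexx => /(_ isT erefl isT); lra.
have [|||k le_tk lt_kN|sigma Usigma] := optimal_survival_proportional optU (t := t).
- by lia.
- by rewrite Ut1 Ut //; lra.
- by move=> k _; apply: a_gt0.
- rewrite /a !ltnNge le_tk (leqW le_tk) /= gtn_eqF ?ltnS //.
  by case: eqP => // _; lra.
have := Usigma t.+1; have := Usigma t.
rewrite Ut1 Ut2 /a ltnn eqxx [(t.+1 < t)%N]ltnNge leqnSn /= gtn_eqF // leqnn mulr1.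
rewrite (lt_t1N : (t < N)%N) => /(_ isT) <-.
have -> : (t.+1 < N)%N by lia.
by move=> /(_ isT); move: pE => /eqP; lra.
Qed.
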